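(* There exist a (finite) Kuhn decision tree without perfect recall, with real payoffs at terminal nodes and a probability measure on Nature's states, a family of finite signal sets, a quantum signal structure on it, and a strategy profile $f$ using these quantum signals, such that the expected payoff of $f$ is strictly higher than the expected payoff of every strategy profile under every classical signal structure (with any finite signal sets) on the same tree.
   Context: Kuhn decision tree: a finite rooted tree whose non-terminal nodes are partitioned into decision nodes (of the decision maker (DM), i.e. the team) and chance nodes (of Nature). Decision nodes are partitioned into information sets $I$, and chance nodes into information sets $J$, such that (i) all nodes in the same information set have the same number of outgoing branches, with a given 1-1 correspondence between the outgoing branches of different nodes of the set (so each $I$ has a well-defined set $M_I$ of moves, and likewise each $J$); (ii) every path from the root to a terminal node crosses each information set at most once. Each terminal node $z$ carries a real payoff $u(z)$. A state of Nature $\psi$ selects a move at each information set $J$; a probability measure $\nu$ on the finite set of states is given. For a terminal node $z$, write $\nu(z)$ for the $\nu$-probability of the set of states that select, at every chance node on the path to $z$, the branch on that path. Perfect recall: a (signal-free) strategy $s$ selects a move at each information set $I$; a decision node $n$ is allowed under $s$ if there is a state $\psi$ such that the path induced by $(s,\psi)$ passes through $n$. The DM has perfect recall if for every strategy $s$, information set $I$ and nodes $n,n^*\in I$, node $n$ is allowed under $s$ if and only if $n^*$ is. Sequences: for a terminal node $z$, let $\sigma(z) = I_{i_1}\cdots I_{i_K}$ be the sequence of information sets of the team crossed, in order, by the path from the root to $z$. These are the sequences that arise in the tree. Signal structure: given finite non-empty signal sets $\Omega_I$, an assignment, to each sequence $\sigma = I_{i_1}\cdots I_{i_K}$ that arises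 in the tree, of a probability measure $\mathrm{Pr}_\sigma$ on $\Omega_{I_{i_1}}\times\cdots\times\Omega_{I_{i_K}}$. Classical signal structure: there is a probability measure $\mu$ on $\prod_I \Omega_I$ such that every $\mathrm{Pr}_\sigma$ is the corresponding marginal of $\mu$. Quantum signal structure: there are finite-dimensional complex Hilbert spaces $H_1,\dots,H_r$ (subsystems, or particles), a density operator $\rho$ on $H_1\otimes\cdots\otimes H_r$, an assignment $I \mapsto j(I)\in\{1,\dots,r\}$ with $j(I)\neq j(I')$ whenever distinct $I,I'$ occur in a common sequence that arises in the tree, and for each $I$ a measurement (POVM) $\{E_I^\omega\}_{\omega\in\Omega_I}$ on $H_{j(I)}$ (positive semidefinite operators summing to the identity), such that $\mathrm{Pr}_\sigma(\omega_{1},\dots,\omega_{K}) = \mathrm{tr}\big(\rho \prod_{k=1}^K \widetilde{E}_{I_{i_k}}^{\omega_k}\big)$ for each $\sigma=I_{i_1}\cdots I_{i_K}$, where $\widetilde{E}$ denotes the operator $E$ tensored with the identity on the other factors. Strategy profiles with signals and their expected payoffs: a strategy profile is a tuple $f = (f_I)_I$ of maps $f_I : \Omega_I \to M_I$. Signals are independent of Nature, so its expected payoff is $$\Pi(f) = \sum_{z} \nu(z)\, \mathrm{Pr}_{\sigma(z)}\big(\{(\omega_I)_{I\in\sigma(z)} : f_I(\omega_I) = m_I^z \text{ for all } I \in \sigma(z)\}\big)\, u(z),$$ where $z$ ranges over terminal nodes and $m_I^z$ is the move at $I$ taken by the path to $z$. *)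

(* Defs.v *)
From HB Require Import structures.
From mathcomp Require Import all_boot all_order all_algebra.
From mathcomp Require Import sesquilinear spectral.
From mathcomp Require Import complex.
From mathcomp Require Import reals.

Set Implicit Arguments.
Unset Strict Implicit.
Unset Printing Implicit Defensive.

Import Order.TTheory GRing.Theory Num.Theory.
Local Open Scope ring_scope.
Local Open Scope sesquilinear_scope.

(* A probability measure on a finite set, given by its mass function. *)
Definition is_prob (R : realType) (X : finType) (p : X -> R) : Prop :=
  (forall x, 0 <= p x) /\ \sum_x p x = 1.

Section Trees.
Variables (R : realType) (D C : finType) (M : D -> finType) (N : C -> finType).

(* D and C index the information sets of the decision maker and of Nature.
   The branches out of every node of a decision (resp. chance) information set
   I are labelled by the same set of moves M I (resp. N I): this is the given
   one-to-one correspondence between the branches of nodes of the same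
   information set. *)
Inductive tree : Type :=
| Terminal (u : R)
| Decision (I : D) (next : M I -> tree)
| Chance (J : C) (next : N J -> tree).

Definition step : Type := ({I : D & M I} + {J : C & N J})%type.
Definition history : Type := seq step.

Definition dstep (I : D) (m : M I) : step := inl (Tagged M m).
Definition cstep (J : C) (m : N J) : step := inr (Tagged N m).

Definition step_infoset (e : step) : D + C :=
  match e with inl a => inl (tag a) | inr b => inr (tag b) end.

(* All nodes of the tree; a node is identified by the path from the root to it
   and is listed with the subtree hanging below it. *)
Fixpoint nodes (t : tree) : seq (history * tree) :=
  ([::], t) ::
  match t with
  | Terminal _ => [::]
  | Decision i next =>
      flatten [seq [seq (dstep m :: n.1, n.2) | n <- nodes (next m)]
              | m <- enum {: M i}]
  | Chance j next =>
      flatten [seq [seq (cstep m :: n.1, n.2) | n <- nodes (next m)]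
              | m <- enum {: N j}]
  end.

Definition node_infoset (t : tree) : option (D + C) :=
  match t with
  | Terminal _ => None
  | Decision i _ => Some (inl i)
  | Chance j _ => Some (inr j)
  end.

Definition infoset_nodes (t : tree) (k : D + C) : seq history :=
  [seq n.1 | n <- nodes t & node_infoset n.2 == Some k].

(* The terminal nodes, listed with their payoffs. *)
Definition tree_terminals (t : tree) : seq (history * R) :=
  pmap (fun n : history * tree =>
          if n.2 is Terminal u then Some (n.1, u) else None) (nodes t).

Definition seq_of (h : history) : seq D :=
  pmap (fun e : step => if e is inl a then Some (tag a) else None) h.

(* The path from the root to the terminal node selected by strategy s and
   state of Nature psi. *)
Fixpoint tree_play (s : forall I, M I) (psi : forall J, N J) (t : tree)
    : history :=
  match t with
  | Terminal _ => [::]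
  | Decision i next => dstep (s i) :: tree_play s psi (next (s i))
  | Chance j next => cstep (psi j) :: tree_play s psi (next (psi j))
  end.

Definition selects (psi : forall J, N J) (h : history) : bool :=
  all (fun e : step => if e is inr b then psi (tag b) == tagged b else true) h.

End Trees.

(* Non-terminal nodes have at least one branch, and the blocks of the partition
   into information sets are non-empty. *)
Record kuhn_tree (R : realType) : Type := KuhnTree {
  dinfo : finType;
  cinfo : finType;
  dmove : dinfo -> finType;
  cmove : cinfo -> finType;
  ktree : tree R dmove cmove;
  dmove_gt0 : forall I, (0 < #|dmove I|)%N;
  cmove_gt0 : forall J, (0 < #|cmove J|)%N;
  infoset_inhabited : forall k, infoset_nodes ktree k != [::];
  infoset_once : all (fun z => uniq [seq step_infoset e | e <- z.1])
                     (tree_terminals ktree)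
}.

Section KuhnTree.
Variables (R : realType) (T : kuhn_tree R).

Definition kpath : Type := history (@dmove _ T) (@cmove _ T).

Definition terminals : seq (kpath * R) := tree_terminals (ktree T).

Definition sigma (z : kpath) : seq (dinfo T) := seq_of z.

Definition sequences : seq (seq (dinfo T)) :=
  [seq sigma z.1 | z <- terminals].

Definition strategy : Type := forall I : dinfo T, dmove I.

Definition state : finType := {dffun forall J : cinfo T, cmove J}.

Definition allowed (s : strategy) (n : kpath) : Prop :=
  exists psi : state, prefix n (tree_play s psi (ktree T)).

Definition perfect_recall : Prop :=
  forall (s : strategy) (I : dinfo T) (n n' : kpath),
    n \in infoset_nodes (ktree T) (inl I) ->
    n' \in infoset_nodes (ktree T) (inl I) ->
    (allowed s n <-> allowed s n').

Definition nature_prob (nu : state -> R) (z : kpath) : R :=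
  \sum_(psi : state | selects psi z) nu psi.

(* Families of signals along a sequence: the product of the Omega_I over the
   successive entries I of sg. *)
Definition signals_on (Omega : dinfo T -> finType) (sg : seq (dinfo T))
    : finType :=
  {dffun forall k : 'I_(size sg), Omega (tnth (in_tuple sg) k)}.

(* The values of sigPr on sequences that do not arise in the tree are
   irrelevant: nothing below depends on them. *)
Record signal_structure : Type := SignalStructure {
  signal : dinfo T -> finType;
  signal_gt0 : forall I, (0 < #|signal I|)%N;
  sigPr : forall sg : seq (dinfo T), signals_on signal sg -> R;
  sigPr_prob : forall sg, sg \in sequences -> is_prob (@sigPr sg)
}.

Definition marginal (Omega : dinfo T -> finType)
    (mu : {dffun forall I : dinfo T, Omega I} -> R)
    (sg : seq (dinfo T)) (w : signals_on Omega sg) : R :=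
  \sum_(om : {dffun forall I : dinfo T, Omega I}
        | [forall k, om (tnth (in_tuple sg) k) == w k]) mu om.

Definition classical (S : signal_structure) : Prop :=
  exists mu : {dffun forall I : dinfo T, signal S I} -> R,
    is_prob mu /\
    forall sg, sg \in sequences ->
      forall w : signals_on (signal S) sg, sigPr w = marginal mu w.

End KuhnTree.

Section Quantum.
Variable R : realType.

Definition psd (n : nat) (A : 'M[R[i]]_n) : Prop :=
  A \is hermsymmx /\ forall v : 'cV[R[i]]_n, 0 <= (v ^t* *m A *m v) 0 0.

Definition density (n : nat) (rho : 'M[R[i]]_n) : Prop :=
  psd rho /\ \tr rho = 1.

Definition povm (X : finType) (n : nat) (E : X -> 'M[R[i]]_n) : Prop :=
  (forall x, psd (E x)) /\ \sum_x E x = 1%:M.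

Variables (r : nat) (d : 'I_r -> nat).

(* H_j is the Hilbert space of dimension d j with its standard basis, so the
   tensor product of the H_j has the product basis, indexed by the families
   (x_j)_j with x_j < d j. *)
Definition tensor_dim : nat := #|{dffun forall j : 'I_r, 'I_(d j)}|.

Definition tensor (A : forall j : 'I_r, 'M[R[i]]_(d j)) : 'M[R[i]]_tensor_dim :=
  \matrix_(x, y) \prod_j A j ((enum_val x : {dffun forall j : 'I_r, 'I_(d j)}) j)
                             ((enum_val y : {dffun forall j : 'I_r, 'I_(d j)}) j).

(* E on the factor j, tensored with the identity on the other factors. *)
Definition ampliation (j : 'I_r) (E : 'M[R[i]]_(d j)) : 'M[R[i]]_tensor_dim :=
  tensor (dfwith (fun k : 'I_r => 1%:M : 'M[R[i]]_(d k)) E).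

End Quantum.

Section Payoff.
Variables (R : realType) (T : kuhn_tree R).
Local Open Scope complex_scope.

Definition quantum (S : signal_structure T) : Prop :=
  exists (r : nat) (d : 'I_r -> nat) (rho : 'M[R[i]]_(tensor_dim d))
         (part : dinfo T -> 'I_r)
         (E : forall I : dinfo T, signal S I -> 'M[R[i]]_(d (part I))),
    [/\ density rho,
        (forall sg, sg \in sequences T -> {in sg &, injective part}),
        (forall I, povm (@E I)) &
        (forall sg, sg \in sequences T ->
           forall w : signals_on (signal S) sg,
             (sigPr w)%:C =
             \tr (rho *m \prod_(k < size sg)
                           ampliation (@E (tnth (in_tuple sg) k) (w k))))].

Definition profile (S : signal_structure T) : Type :=
  forall I : dinfo T, signal S I -> dmove I.

(* As the path to z crosses I at most once, "f_I(omega_I) is the move taken at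
   I by the path to z" says that the step (I, f_I(omega_I)) is on this path. *)
Definition agrees (S : signal_structure T) (f : profile S) (z : kpath T)
    (w : signals_on (signal S) (sigma z)) : bool :=
  [forall k, dstep (@cmove _ T) (f (tnth (in_tuple (sigma z)) k) (w k)) \in z].

Definition expected_payoff (nu : state T -> R) (S : signal_structure T)
    (f : profile S) : R :=
  \sum_(z <- terminals T)
    nature_prob nu z.1
    * (\sum_(w : signals_on (signal S) (sigma z.1) | agrees f w) sigPr w)
    * z.2.

End Payoff.

(* Main.v *)
From HB Require Import structures.
Require Import Defs.
From mathcomp Require Import all_boot all_order all_algebra reals.
From mathcomp Require Import sesquilinear spectral complex ring lra.

(* The CHSH game as a decision tree: Nature draws two questions x, y uniformly,
   the first player answers a to x, and the second answers b to y, having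
   forgotten a; the payoff is 1 if a (+) b = x && y and 0 otherwise. A classical
   signal structure only mixes pure strategies, each of which wins on at most 3
   of the 4 pairs of questions, so its payoff is at most 3/4. Measuring the two
   halves of a Bell pair with the projections (1 + (-1)^a (cos t Z + sin t X))/2,
   for angles t with rational sine and cosine, gives answers with
   P(a, b) = (1 + (-1)^(a (+) b) cos (t - t'))/4 and payoff 421/500. *)

Set Implicit Arguments.
Unset Strict Implicit.
Unset Printing Implicit Defensive.

Import Order.TTheory GRing.Theory Num.Theory.
Local Open Scope ring_scope.
Local Open Scope complex_scope.
Local Open Scope sesquilinear_scope.

(** * Folds over terminal nodes and membership in information sets *)

Section BigTerminals.
Variables (R : realType) (D C : finType) (M : D -> finType) (N : C -> finType).
Variables (S : Type) (idx : S) (op : Monoid.com_law idx).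
Implicit Type F : history M N * R -> S.

(** An arbitrary commutative monoid is allowed so that one recursion serves payoffs (sums), [all]
    (conjunctions) and [has] (disjunctions). *)
Lemma big_terminals (t : tree R M N) F :
  \big[op/idx]_(z <- tree_terminals t) F z =
  \big[op/idx]_(n <- nodes t)
     (if n.2 is Terminal u then F (n.1, u) else idx).
Proof.
rewrite /tree_terminals big_pmap; apply: eq_bigr => -[h []] //.
Qed.

Lemma big_terminals_Terminal (u : R) F :
  \big[op/idx]_(z <- tree_terminals (Terminal M N u)) F z = F ([::], u).
Proof. by rewrite big_terminals /= big_seq1. Qed.

Lemma big_terminals_Decision (i : D) (next : M i -> tree R M N) F :
  \big[op/idx]_(z <- tree_terminals (Decision next)) F z =
  \big[op/idx]_(m : M i)
     \big[op/idx]_(z <- tree_terminals (next m)) F (dstep N m :: z.1, z.2).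
Proof.
rewrite big_terminals /= big_cons Monoid.mul1m big_flatten big_map big_enum.
by apply: eq_bigr => m _; rewrite big_map big_terminals.
Qed.

Lemma big_terminals_Chance (j : C) (next : N j -> tree R M N) F :
  \big[op/idx]_(z <- tree_terminals (Chance next)) F z =
  \big[op/idx]_(m : N j)
     \big[op/idx]_(z <- tree_terminals (next m)) F (cstep M m :: z.1, z.2).
Proof.
rewrite big_terminals /= big_cons Monoid.mul1m big_flatten big_map big_enum.
by apply: eq_bigr => m _; rewrite big_map big_terminals.
Qed.

End BigTerminals.

Section InfosetNodes.
Variables (R : realType) (D C : finType) (M : D -> finType) (N : C -> finType).
Implicit Type t : tree R M N.

Lemma root_infoset_nodes t k :
  node_infoset t = Some k -> [::] \in infoset_nodes t k.
Proof.
by case: t => [u|i next|j next] //= [<-]; rewrite /infoset_nodes /= eqxx inE.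
Qed.

(** The [has] form lets [big_has] turn membership into a disjunction over moves. *)
Lemma mem_infoset_nodes t k h :
  (h \in infoset_nodes t k) =
  has (fun n => (node_infoset n.2 == Some k) && (n.1 == h)) (nodes t).
Proof.
rewrite /infoset_nodes; elim: (nodes t) => //= n s IHs.
by case: ifP => _ //; rewrite inE IHs eq_sym.
Qed.

Lemma infoset_nodes_dstep (i : D) (next : M i -> tree R M N) m h k :
  h \in infoset_nodes (next m) k ->
  dstep N m :: h \in infoset_nodes (Decision next) k.
Proof.
rewrite !mem_infoset_nodes /= => hin; apply/orP; right.
rewrite -big_has big_flatten big_map big_enum (bigD1 m) //= big_has has_map.
by apply/orP; left; apply: sub_has hin => n /= /andP[-> /eqP->]; rewrite eqxx.
Qed.

Lemma infoset_nodes_cstep (j : C) (next : N j -> tree R M N) m h k :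
  h \in infoset_nodes (next m) k ->
  cstep M m :: h \in infoset_nodes (Chance next) k.
Proof.
rewrite !mem_infoset_nodes /= => hin; apply/orP; right.
rewrite -big_has big_flatten big_map big_enum (bigD1 m) //= big_has has_map.
by apply/orP; left; apply: sub_has hin => n /= /andP[-> /eqP->]; rewrite eqxx.
Qed.

End InfosetNodes.

(** Each global signal [om] restricts to exactly one family [w0] along [sg], so after exchanging the
    sums it contributes [mu om] or 0 according to [P w0]. *)
Lemma sum_marginal (R : realType) (T : kuhn_tree R) (Omega : dinfo T -> finType)
    (mu : {dffun forall I : dinfo T, Omega I} -> R) (sg : seq (dinfo T))
    (P : pred (signals_on Omega sg)) :
  \sum_(w | P w) marginal mu w =
  \sum_(om : {dffun forall I : dinfo T, Omega I}
        | P [ffun k => om (tnth (in_tuple sg) k)]) mu om.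
Proof.
rewrite /marginal (exchange_big_dep xpredT) //= [RHS]big_mkcond /=.
apply: eq_bigr => om _.
pose w0 : signals_on Omega sg := [ffun k => om (tnth (in_tuple sg) k)].
rewrite -/w0 (eq_bigl (fun w => P w && (w == w0))); last first.
  move=> w; congr (_ && _); apply/forallP/eqP => [e | -> k].
    by apply/ffunP => k; rewrite ffunE; apply/esym/eqP.
  by rewrite ffunE.
case: ifP => Pw0.
  by rewrite (big_pred1 w0) // => w /=; case: eqP => [->|]; rewrite ?Pw0 ?andbF.
by rewrite big_pred0 // => w; case: eqP => [->|]; rewrite ?Pw0 ?andbF.
Qed.


(* The decision information sets are the pairs (player, question), with [false]
   the first player; Nature's only move is the pair of questions. *)
Definition chsh_answer (I : bool * bool) : finType := bool.
Definition chsh_questions (J : unit) : finType := (bool * bool)%type.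

Local Notation ask q := (@cstep _ _ chsh_answer chsh_questions tt q).
Local Notation answer I a := (@dstep _ _ chsh_answer chsh_questions I a).

(** * The CHSH tree, its imperfect recall and uniform Nature *)

Section Chsh.
Variable R : realType.

Definition chsh_tree : tree R chsh_answer chsh_questions :=
  @Chance _ _ _ chsh_answer chsh_questions tt (fun q : bool * bool =>
    @Decision _ _ _ chsh_answer chsh_questions (false, q.1) (fun a : bool =>
      @Decision _ _ _ chsh_answer chsh_questions (true, q.2) (fun b : bool =>
        Terminal chsh_answer chsh_questions (a (+) b == q.1 && q.2)%:R))).

Lemma big_chsh_terminals (S : Type) (idx : S) (op : Monoid.com_law idx) F :
  \big[op/idx]_(z <- tree_terminals chsh_tree) F z =
  \big[op/idx]_(q : bool * bool) \big[op/idx]_(a : bool) \big[op/idx]_(b : bool)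
    F ([:: ask q; answer (false, q.1) a; answer (true, q.2) b],
       (a (+) b == q.1 && q.2)%:R).
Proof.
rewrite big_terminals_Chance; apply: eq_bigr => q _.
rewrite big_terminals_Decision; apply: eq_bigr => a _.
rewrite big_terminals_Decision; apply: eq_bigr => b _.
by rewrite big_terminals_Terminal.
Qed.

Lemma chsh_answer_gt0 I : (0 < #|chsh_answer I|)%N.
Proof. by rewrite card_bool. Qed.

Lemma chsh_questions_gt0 J : (0 < #|chsh_questions J|)%N.
Proof. by rewrite card_prod card_bool. Qed.

Lemma mem_chsh_nodes (q : bool * bool) (a : bool) :
  [:: ask q; answer (false, q.1) a]
    \in infoset_nodes chsh_tree (inl (true, q.2)).
Proof.
apply: infoset_nodes_cstep; apply: infoset_nodes_dstep.
exact: root_infoset_nodes.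
Qed.

Lemma chsh_inhabited k : infoset_nodes chsh_tree k != [::].
Proof.
pose hist := history chsh_answer chsh_questions.
have nz (h : hist) (s : seq hist) : h \in s -> s != [::] by case: s.
case: k => [[[] x]|[]].
- exact: (nz _ _ (mem_chsh_nodes (x, x) false)).
- apply: (nz [:: ask (x, x)]).
  by apply: infoset_nodes_cstep; apply: root_infoset_nodes.
- apply: (nz [::]); exact: root_infoset_nodes.
Qed.

Lemma chsh_once : all (fun z => uniq [seq step_infoset e | e <- z.1])
                      (tree_terminals chsh_tree).
Proof.
(* The neutral element of conjunction is [true], so [big1] reduces the claim to one generic path. *)
by rewrite -big_all big_chsh_terminals; do 3!(apply: big1 => ? _).
Qed.

Definition chsh : kuhn_tree R :=
  KuhnTree chsh_answer_gt0 chsh_questions_gt0 chsh_inhabited chsh_once.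

Lemma chsh_sequences sg :
  sg \in sequences chsh -> exists x y, sg = [:: (false, x); (true, y)].
Proof.
suff /allP/[apply]: all (fun sg => [exists x, exists y,
    sg == [:: (false, x); (true, y)]]) (sequences chsh).
  by case/existsP=> x /existsP[y /eqP->]; exists x, y.
rewrite all_map -big_all big_chsh_terminals.
do 3!(apply: big1 => ? _).
by apply/existsP; eexists; apply/existsP; eexists; apply/eqP.
Qed.

(** The second player's information set contains the nodes after both answers of the first, but the
    constant strategy [false] allows only one of them. *)
Lemma chsh_imperfect_recall : ~ perfect_recall chsh.
Proof.
pose s : strategy chsh := fun=> false.
pose q := (false, false).
move=> /(_ s (true, false) _ _
          (mem_chsh_nodes q false) (mem_chsh_nodes q true)).
case=> recall _; case: recall.
  by exists [ffun=> q : chsh_questions tt]; rewrite /= ffunE !eqxx.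
(* Reading off the move turns an equality of steps into [true = false]. *)
pose answer_of (e : step chsh_answer chsh_questions) : bool :=
  if e is inl a then tagged a else false.
by move=> psi /= /and3P[_ /eqP/(congr1 answer_of)].
Qed.

Definition uniform_nature (psi : state chsh) : R := 1 / 4.

Lemma uniform_nature_prob : is_prob uniform_nature.
Proof.
split=> [psi|]; first by rewrite /uniform_nature; lra.
rewrite /uniform_nature sumr_const.
rewrite (eq_card (B := {ffun unit -> bool * bool})) // card_ffun card_prod.
rewrite card_bool card_unit; lra.
Qed.

(** The constant function [q] is the only state that selects the path. *)
Lemma nature_prob_chsh (q : bool * bool)
    (h : seq (step chsh_answer chsh_questions)) :
  all (fun e => if e is inr _ then false else true) h ->
  nature_prob uniform_nature (ask q :: h : kpath chsh) = 1 / 4.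
Proof.
move=> nh; rewrite /nature_prob.
rewrite (big_pred1 [ffun=> q : chsh_questions tt]) // => psi /=.
rewrite (_ : selects _ h); last first.
  by apply/allP => e /(allP nh); case: e.
rewrite andbT; apply/eqP/eqP => [e|->]; last by rewrite ffunE.
by apply/ffunP => -[]; rewrite ffunE.
Qed.
End Chsh.

Lemma big_ffun2 (S : Type) (idx : S) (op : Monoid.com_law idx) (X : finType)
    (F : {ffun 'I_2 -> X} -> S) :
  \big[op/idx]_(w : {ffun 'I_2 -> X}) F w =
  \big[op/idx]_(a : X) \big[op/idx]_(b : X)
    F [ffun k : 'I_2 => if k == ord0 then a else b].
Proof.
rewrite pair_bigA /=.
pose pair_fun (p : X * X) := [ffun k : 'I_2 => if k == ord0 then p.1 else p.2].
rewrite (reindex pair_fun) //=.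
exists (fun w => (w ord0, w (lift ord0 ord0))) => [[a b] _|w _].
  by rewrite /pair_fun !ffunE.
apply/ffunP => k; rewrite ffunE /=; case: eqP => [->//|/eqP].
by case: (unliftP ord0 k) => [j ->|-> //] _; rewrite (ord1 j).
Qed.

(** For a Hermitian idempotent Q, v^* Q v is the squared norm of Q v. The Bell state and all the
    effects are of this kind. *)
Lemma psd_real_projection (R : realType) n (P : 'M[R]_n) :
  P^T = P -> P *m P = P -> psd (map_mx (real_complex R) P).
Proof.
set Q := map_mx _ P => symP idP.
have adjQ : Q ^t* = Q.
  apply/matrixP => i j; rewrite !mxE -{1}symP mxE.
  by apply/CrealP; rewrite complex_real.
split.
  by apply/is_hermitianmxP; rewrite expr0 scale1r adjQ.
move=> v.
have -> : v ^t* *m Q *m v = (Q *m v) ^t* *m (Q *m v).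
  by rewrite trmx_mul map_mxM adjQ mulmxA -(mulmxA _ Q Q) -map_mxM idP.
by rewrite mxE sumr_ge0 // => i _; rewrite !mxE mulrC mul_conjC_ge0.
Qed.

Section Steps.
Variables (D C : finType) (M : D -> finType) (N : C -> finType).

Lemma dstep_eq (I : D) (m m' : M I) : (dstep N m == dstep N m') = (m == m').
Proof. by rewrite (inj_eq inl_inj) eq_Tagged. Qed.

Lemma dstep_neq (I I' : D) (m : M I) (m' : M I') :
  I != I' -> (dstep N m == dstep N m') = false.
Proof.
by move=> /eqP neq; apply/eqP => /(congr1 (@step_infoset _ _ _ _)) [].
Qed.

Lemma dstep_eq_cstep (I : D) (J : C) (m : M I) (m' : N J) :
  (dstep N m == cstep M m') = false.
Proof. exact/eqP. Qed.

End Steps.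

(** * Two qubits and the Bell state *)

Definition qubit (j : 'I_2) : nat := 2.
Definition second : 'I_2 := lift ord0 ord0.

Lemma ord2_cases (k : 'I_2) : k = ord0 \/ k = second.
Proof. by case: k => [[|[|//]] lek]; [left | right]; apply: val_inj. Qed.

Section Tensor.
Variable R : realType.
Local Notation basis := {ffun 'I_2 -> 'I_2}.

Definition basis_of (x : 'I_(tensor_dim qubit)) : basis :=
  (enum_val x : {dffun forall j : 'I_2, 'I_(qubit j)}).

Lemma sum_basis (V : nmodType) (F : basis -> V) :
  \sum_(x < tensor_dim qubit) F (basis_of x) =
  \sum_(a < 2) \sum_(b < 2) F [ffun k : 'I_2 => if k == ord0 then a else b].
Proof.
rewrite -big_ffun2.
by rewrite (@big_enum_val _ _ _ _ predT F).
Qed.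

(** For sums against the Bell state, which is supported on the labels 00 and 11. *)
Lemma sum_basis_diag (V : nmodType) (F : basis -> V) :
  (forall z : basis, z ord0 != z second -> F z = 0) ->
  \sum_(x < tensor_dim qubit) F (basis_of x) = \sum_(i < 2) F [ffun=> i].
Proof.
move=> F0; rewrite sum_basis; apply: eq_bigr => a _.
rewrite (bigD1 a) //= big1 ?addr0 => [|b /negPf ab].
  by congr F; apply/ffunP => k; rewrite !ffunE; case: ifP.
by apply: F0; rewrite !ffunE /= eq_sym ab.
Qed.

Lemma ampliation_first (A : 'M[R[i]]_2) x y :
  @ampliation R 2 qubit ord0 A x y =
  A (basis_of x ord0) (basis_of y ord0) *
  (basis_of x second == basis_of y second)%:R.
Proof.
rewrite mxE !big_ord_recl big_ord0 mulr1 dfwith_in dfwith_out //.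
by congr (_ * _); rewrite mxE.
Qed.

Lemma ampliation_second (B : 'M[R[i]]_2) x y :
  @ampliation R 2 qubit second B x y =
  (basis_of x ord0 == basis_of y ord0)%:R *
  B (basis_of x second) (basis_of y second).
Proof.
rewrite mxE !big_ord_recl big_ord0 mulr1 dfwith_in dfwith_out //.
by congr (_ * _); rewrite mxE.
Qed.

(** The identity factors force the intermediate label to take its first bit from [y] and its second
    from [x], which leaves the Kronecker product. *)
Lemma mul_ampliation (A B : 'M[R[i]]_2) x y :
  (@ampliation R 2 qubit ord0 A *m @ampliation R 2 qubit second B) x y =
  A (basis_of x ord0) (basis_of y ord0) *
  B (basis_of x second) (basis_of y second).
Proof.
rewrite mxE.
pose F (z : basis) := A (basis_of x ord0) (z ord0) *
  (basis_of x second == z second)%:R *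
  ((z ord0 == basis_of y ord0)%:R * B (z second) (basis_of y second)).
rewrite (eq_bigr (F \o basis_of)) => [|z _]; last first.
  by rewrite ampliation_first ampliation_second.
rewrite sum_basis /F /=.
rewrite (bigD1 (basis_of y ord0)) //= [X in _ + X]big1 => [|a /negPf ya].
  rewrite addr0 (bigD1 (basis_of x second)) //= big1 => [|b /negPf xb].
    by rewrite !ffunE /= !eqxx mulr1 mul1r addr0.
  by rewrite !ffunE /= eq_sym xb mulr0 mul0r.
by apply: big1 => b _; rewrite !ffunE /= ya mul0r mulr0.
Qed.

(** The projection onto the unit vector (|00> + |11>)/sqrt 2, whose entries are rational. *)
Definition bell : 'M[R]_(tensor_dim qubit) :=
  \matrix_(x, y) (2^-1 * (basis_of x ord0 == basis_of x second)%:R *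
                         (basis_of y ord0 == basis_of y second)%:R).

(** Both indices of the trace are confined to 00 and 11, where the entries of [bell] are 1/2. *)
Lemma trace_bell (X : 'M[R[i]]_(tensor_dim qubit))
    (G : basis -> basis -> R[i]) :
  (forall x y, X x y = G (basis_of x) (basis_of y)) ->
  \tr (map_mx (real_complex R) bell *m X) =
  2^-1 * \sum_(i < 2) \sum_(j < 2) G [ffun=> i] [ffun=> j].
Proof.
move=> XG.
pose H (x y : basis) : R[i] :=
  2^-1 * (x ord0 == x second)%:R * (y ord0 == y second)%:R * G y x.
have -> : \tr (map_mx (real_complex R) bell *m X) =
    \sum_x \sum_y H (basis_of x) (basis_of y).
  apply: eq_bigr => x _; rewrite mxE; apply: eq_bigr => y _.
  by rewrite !mxE XG /H !rmorphM fmorphV !rmorph_nat.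
rewrite (sum_basis_diag (F := fun x => \sum_y H x (basis_of y)));
  last first.
  by move=> z /negPf z0; apply: big1 => y _; rewrite /H z0 mulr0 !mul0r.
rewrite exchange_big (sum_basis_diag (F := fun y => \sum_i H [ffun=> i] y)).
  rewrite mulr_sumr; apply: eq_bigr => i _.
  rewrite mulr_sumr; apply: eq_bigr => j _.
  by rewrite /H !ffunE !eqxx !mulr1.
by move=> z /negPf z0; apply: big1 => i _; rewrite /H z0 mulr0 mul0r.
Qed.

Lemma bell_density : density (map_mx (real_complex R) bell).
Proof.
split.
  apply: psd_real_projection; apply/matrixP => x y; rewrite !mxE.
    by rewrite mulrAC.
  pose F (z : basis) : R :=
    2^-1 * (basis_of x ord0 == basis_of x second)%:R *
      (z ord0 == z second)%:R *
    (2^-1 * (z ord0 == z second)%:R *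
      (basis_of y ord0 == basis_of y second)%:R).
  rewrite (eq_bigr (F \o basis_of)) => [|z _]; last by rewrite !mxE.
  rewrite sum_basis /F /=.
  rewrite !big_ord_recl !big_ord0 !ffunE /=.
  by field.
(* The trace is that of a product with the identity, so [trace_bell] applies with [G] the Kronecker
   delta. *)
rewrite -[map_mx _ _]mulmx1.
rewrite (@trace_bell _ (fun x y => (x == y)%:R)) => [|x y].
  have eq_const (i j : 'I_2) : ([ffun=> i] == [ffun=> j] :> basis) = (i == j).
    by apply/eqP/eqP => [/ffunP/(_ ord0)|->//]; rewrite !ffunE.
  by rewrite !big_ord_recl !big_ord0 !eq_const /=; field.
by rewrite mxE (inj_eq enum_val_inj).
Qed.

End Tensor.

(** * Projective measurements of one qubit *)

Section Effects.
Variable R : realType.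
Implicit Types x y : R * R.

(** This is cos t Z + sin t X, the angle being given by the point [x] = (cos t, sin t). *)
Definition reflection x : 'M[R]_2 :=
  \matrix_(i, j) if i == j then (-1) ^+ i * x.1 else x.2.

Definition effect x (s : bool) : 'M[R]_2 :=
  2^-1 *: (1%:M + (-1) ^+ s *: reflection x).

(** A reflection along a unit vector squares to 1, so both effects are projections; their reflection
    terms cancel in the sum. *)
Lemma effect_povm x : x.1 ^+ 2 + x.2 ^+ 2 = 1 ->
  povm (fun s => map_mx (real_complex R) (effect x s)).
Proof.
move=> x1; split=> [s|].
  apply: psd_real_projection.
    by apply/matrixP => i j; rewrite !mxE eq_sym; case: eqP => [->|].
  apply/matrixP => -[[|[|//]] ?] [[|[|//]] ?];
    rewrite !mxE !big_ord_recl big_ord0 !mxE /=;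
    case: s; rewrite /bump /=; lra.
rewrite big_bool /= -map_mxD -[RHS](map_mx1 (real_complex R)); congr map_mx.
by apply/matrixP => i j; rewrite !mxE /=; field.
Qed.

(** By symmetry the double sum is the trace of the product of the two effects. Reflections are
    traceless, and a product of two has trace twice the inner product of [x] and [y]. *)
Lemma effect_correlation x y s t :
  2^-1 * \sum_(i < 2) \sum_(j < 2) effect x s i j * effect y t i j =
  4^-1 * (1 + (-1) ^+ (s (+) t) * (x.1 * y.1 + x.2 * y.2)).
Proof.
rewrite !big_ord_recl !big_ord0 !mxE /=.
by case: s; case: t; rewrite /= ?expr0 ?expr1; field.
Qed.

End Effects.

(** * The quantum signals and the comparison of payoffs *)

Section QuantumAdvantage.
Variable R : realType.

(** The two questions to one player share a particle, as they never occur in a common sequence. *)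
Definition particle (I : bool * bool) : 'I_2 := if I.1 then second else ord0.

(** With cos t = 3/5 and sin t = 4/5, the first player measures at 0 or 2t and the second at t or
    -t. The angles differ by t on three pairs of questions and by 3t, of cosine -117/125, on the
    pair that asks for distinct answers. The optimal t would be pi/4. *)
Definition observable (I : bool * bool) : R * R :=
  if I.1 then (3 / 5, (-1) ^+ I.2 * (4 / 5))
  else if I.2 then (- 7 / 25, 24 / 25) else (1, 0).

Lemma observable_unit I : (observable I).1 ^+ 2 + (observable I).2 ^+ 2 = 1.
Proof. by case: I => [[] []]; rewrite /observable /=; lra. Qed.

Definition chsh_signal (I : dinfo (chsh R)) : finType := bool.

(* The Born rule for the Bell state: tr (bell (A (x) B)) = sum_ij A_ij B_ij / 2. *)
Definition chsh_pr (sg : seq (dinfo (chsh R)))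
    (w : signals_on chsh_signal sg) : R :=
  2^-1 * \sum_(i < 2) \sum_(j < 2) \prod_(k < size sg)
    effect (observable (tnth (in_tuple sg) k)) (w k) i j.

Lemma chsh_prE x y (w : signals_on chsh_signal [:: (false, x); (true, y)]) :
  chsh_pr w = 4^-1 * (1 + (-1) ^+ (w ord0 (+) w second) *
     ((observable (false, x)).1 * (observable (true, y)).1 +
      (observable (false, x)).2 * (observable (true, y)).2)).
Proof.
rewrite -effect_correlation; congr (_ * _).
apply: eq_bigr => i _; apply: eq_bigr => j _.
by rewrite !big_ord_recl big_ord0 mulr1.
Qed.

(** Correlations lie in [-1, 1], which gives nonnegativity; in the total the parity signs cancel. *)
Lemma chsh_pr_prob sg : sg \in sequences (chsh R) -> is_prob (@chsh_pr sg).
Proof.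
case/chsh_sequences=> x [y ->]; split=> [w|].
  rewrite chsh_prE; case: x w; case: y => w; case: (_ (+) _);
    rewrite /observable /=; lra.
under eq_bigr do rewrite chsh_prE.
rewrite (big_ffun2 _ (fun w : {ffun 'I_2 -> bool} =>
  4^-1 * (1 + (-1) ^+ (w ord0 (+) w second) * _))).
by rewrite !big_bool !ffunE /=; field.
Qed.

Lemma chsh_signal_gt0 I : (0 < #|chsh_signal I|)%N.
Proof. by rewrite card_bool. Qed.

Definition chsh_signals : signal_structure (chsh R) :=
  SignalStructure chsh_signal_gt0 chsh_pr_prob.

Lemma chsh_signals_quantum : quantum chsh_signals.
Proof.
exists 2%N, qubit, (map_mx (real_complex R) (bell R)), particle,
  (fun I s => map_mx (real_complex R) (effect (observable I) s)).
split.
- exact: bell_density.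
- move=> sg /chsh_sequences[x [y ->]] I I'.
  by rewrite !inE => /orP[] /eqP-> /orP[] /eqP->.
- by move=> I; apply: effect_povm; apply: observable_unit.
move=> sg /chsh_sequences[x [y ->]] w.
pose A := map_mx (real_complex R) (effect (observable (false, x)) (w ord0)).
pose B := map_mx (real_complex R) (effect (observable (true, y)) (w second)).
rewrite (trace_bell (G := fun z z' =>
    A (z ord0) (z' ord0) * B (z second) (z' second))); last first.
  by move=> z z'; rewrite -mul_ampliation !big_ord_recl big_ord0 mulr1.
rewrite /= /chsh_pr rmorphM fmorphV rmorph_nat rmorph_sum; congr (_ * _).
apply: eq_bigr => i _; rewrite rmorph_sum; apply: eq_bigr => j _.
by rewrite !big_ord_recl big_ord0 mulr1 rmorphM !ffunE !mxE.
Qed.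

Lemma chsh_sequence x y : [:: (false, x); (true, y)] \in sequences (chsh R).
Proof.
rewrite -has_pred1 has_map -big_has big_chsh_terminals.
by rewrite (bigD1 (x, y)) //= !big_bool eqxx.
Qed.

Lemma chsh_payoffE (S : signal_structure (chsh R)) (f : profile S) :
  expected_payoff (@uniform_nature R) f =
  1 / 4 * \sum_(q : bool * bool) \sum_(a : bool) \sum_(b : bool)
    \sum_(w : signals_on (signal S) [:: (false, q.1); (true, q.2)]
          | (f (false, q.1) (w ord0) == a) && (f (true, q.2) (w second) == b))
      sigPr w * (a (+) b == q.1 && q.2)%:R.
Proof.
rewrite /expected_payoff big_chsh_terminals mulr_sumr.
apply: eq_bigr => q _; rewrite mulr_sumr; apply: eq_bigr => a _.
rewrite mulr_sumr; apply: eq_bigr => b _.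
rewrite nature_prob_chsh // -mulrA -mulr_suml; congr (_ * (_ * _)).
apply: eq_bigl => w.
(* Steps at distinct information sets differ, so membership in the path fixes each answer. *)
apply/forallP/andP => [h|[/eqP h0 /eqP h1] k].
  move: (h ord0) (h second); rewrite !inE !dstep_eq_cstep.
  by rewrite !dstep_eq !dstep_neq ?orbF.
rewrite !inE; have [-> | ->] := ord2_cases k; last first.
  apply/orP; right; apply/orP; right; apply/eqP.
  exact (congr1 (fun m => answer (true, q.2) m) h1).
apply/orP; right; apply/orP; left; apply/eqP.
exact (congr1 (fun m => answer (false, q.1) m) h0).
Qed.

(** For fixed [om] the profile acts as the pure strategy [s om], so the payoff is a [mu]-average of
    pure payoffs. *)
Lemma classical_payoff_le (S : signal_structure (chsh R)) (f : profile S) :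
  classical S -> expected_payoff (@uniform_nature R) f <= 3 / 4.
Proof.
case=> mu [[mu_ge0 mu_sum] prE].
pose win (q : bool * bool) (a b : bool) : R := (a (+) b == q.1 && q.2)%:R.
pose s om I : bool := f I (om I).
have -> : expected_payoff (@uniform_nature R) f =
    \sum_om mu om *
      (1 / 4 * \sum_q win q (s om (false, q.1)) (s om (true, q.2))).
  have prob_win (q : bool * bool) a b :
      \sum_(w : signals_on (signal S) [:: (false, q.1); (true, q.2)]
            | (f (false, q.1) (w ord0) == a) && (f (true, q.2) (w second) == b))
        sigPr w * win q a b =
      \sum_om mu om * (((s om (false, q.1) == a) &&
                        (s om (true, q.2) == b))%:R * win q a b).
    rewrite -mulr_suml (eq_bigr _ (fun w _ => prE _ (chsh_sequence q.1 q.2) w)).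
    rewrite sum_marginal big_mkcond mulr_suml; apply: eq_bigr => om _ /=.
    by rewrite !ffunE /s; case: ifP; rewrite ?mul1r ?mul0r ?mulr0.
  rewrite chsh_payoffE.
  under eq_bigr => q _ do under eq_bigr => a _ do under eq_bigr => b _ do
    rewrite prob_win.
  under eq_bigr => q _ do under eq_bigr => a _ do rewrite exchange_big /=.
  under eq_bigr => q _ do rewrite exchange_big /=.
  rewrite exchange_big mulr_sumr; apply: eq_bigr => om _ /=.
  rewrite mulrCA; congr (_ * _); rewrite mulr_sumr; apply: eq_bigr => q _.
  rewrite !big_bool; case: (s om _); case: (s om _); rewrite /=; ring.
apply: (@le_trans _ _ (\sum_om mu om * (3 / 4))); last first.
  by rewrite -mulr_suml mu_sum mul1r.
apply: ler_sum => om _; rewrite ler_wpM2l //.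
rewrite -(pair_bigA _ (fun x y =>
  win (x, y) (s om (false, x)) (s om (true, y)))) !big_bool /win /=.
(* Sixteen pure strategies. None wins on all four pairs: each answer enters two of the winning
   equations, so their left sides add up to 0 mod 2 and their right sides to 1. *)
case: (s om _); case: (s om _); case: (s om _); case: (s om _); rewrite /=; lra.
Qed.

(** The winning probability is (1 + 3/5)/2 = 4/5 on three pairs of questions and (1 + 117/125)/2 =
    121/125 on the fourth; their mean is 421/500. *)
Lemma quantum_payoff :
  expected_payoff (S := chsh_signals) (@uniform_nature R) (fun I s => s) =
  421 / 500.
Proof.
rewrite chsh_payoffE -(pair_bigA _ (fun x y => \sum_a \sum_b
  \sum_(w : signals_on (signal chsh_signals) [:: (false, x); (true, y)]
        | (w ord0 == a) && (w second == b))
    sigPr w * (a (+) b == x && y)%:R)) /=.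
have pr_answers x y (a b : bool) :
    \sum_(w : signals_on (signal chsh_signals) [:: (false, x); (true, y)]
          | (w ord0 == a) && (w second == b)) sigPr w * (a (+) b == x && y)%:R =
    4^-1 * (1 + (-1) ^+ (a (+) b) *
      ((observable (false, x)).1 * (observable (true, y)).1 +
       (observable (false, x)).2 * (observable (true, y)).2)) *
      (a (+) b == x && y)%:R.
  (* The answers are the signals themselves, so the event is the single outcome [ab]. *)
  pose ab : {ffun 'I_2 -> bool} := [ffun k => if k == ord0 then a else b].
  rewrite (big_pred1 (ab : signals_on (signal chsh_signals)
                             [:: (false, x); (true, y)])) => [|w /=].
    by rewrite /sigPr /= chsh_prE !ffunE.
  apply/andP/eqP => [[/eqP w0 /eqP w1]|->]; last by rewrite !ffunE !eqxx.
  by apply/ffunP => k; rewrite ffunE; have [-> | ->] := ord2_cases k.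
under eq_bigr => x _ do under eq_bigr => y _ do under eq_bigr => a _ do
  under eq_bigr => b _ do rewrite pr_answers.
rewrite !big_bool /observable /=; lra.
Qed.

End QuantumAdvantage.

Theorem proposition6p1 (R : realType) :
  exists (T : kuhn_tree R) (nu : state T -> R)
         (S : signal_structure T) (f : profile S),
    [/\ ~ perfect_recall T, is_prob nu, quantum S &
        forall (S' : signal_structure T) (g : profile S'),
          classical S' -> expected_payoff nu g < expected_payoff nu f].
Proof.
exists (chsh R), (@uniform_nature R), (chsh_signals R), (fun I s => s).
split; first exact: chsh_imperfect_recall.
- exact: uniform_nature_prob.
- exact: chsh_signals_quantum.
move=> S' g /(classical_payoff_le g) le34; apply: le_lt_trans le34 _.
by rewrite quantum_payoff; lra.
Qed.
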